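(* Let $(E,C)$ be a separated graph without isolated vertices. Then: (1) The poset $\mathcal F$ of filters of the semilattice $\mathcal Y$ (ordered by inclusion) is order-isomorphic to the poset $\mathfrak F$. (2) In particular, this order-isomorphism restricts to a bijection between the set of ultrafilters of $\mathcal Y$ and the subset $\mathfrak U\subseteq\mathfrak F$.
   Context: A directed graph $E=(E^0,E^1,s,r)$ consists of sets $E^0$, $E^1$ (arbitrary cardinality) and maps $s,r\colon E^1\to E^0$. A separated graph $(E,C)$ is a directed graph with $C=\bigsqcup_{v}C_v$, where $C_v$ is a partition of $s^{-1}(v)$ into pairwise disjoint nonempty subsets ($C_v=\emptyset$ if $s^{-1}(v)=\emptyset$). A vertex $v$ is isolated if $s^{-1}(v)=r^{-1}(v)=\emptyset$. $E^{-1}=\{e^{-1}:e\in E^1\}$ is a set of formal inverses, $\hat E^1=E^1\sqcup E^{-1}$, $s(e^{-1})=r(e)$, $r(e^{-1})=s(e)$, $(e^{-1})^{-1}=e$. A path is a vertex or a word $y_1\cdots y_n$ with $y_i\in\hat E^1$, $r(y_i)=s(y_{i+1})$; it is reduced if it contains no subword $xx^{-1}$, $x\in\hat E^1$; $\mathrm{red}(\gamma)$ is the reduction of $\gamma$ via $xx^{-1}\to s(x)$. $\mathbb F_C$ is the set of $C$-separated paths: reduced paths (vertices included) with no subword $x^{-1}y$ with $x,y\in X$, $X\in C$; $\mathbb F_C(v)=\{w\in\mathbb F_C:s(w)=v\}$. The prefix order $\mu\le_p\nu$ means that $\mu$ is an initial segment of $\nu$ (''$\mu$ can be extended to $\nu$'');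 lower subsets are with respect to $\le_p$. Vertices count as not ending in $E^{-1}$. $\gamma,\nu\in\mathbb F_C(v)\setminus\{v\}$ are $C$-compatible if $\mathrm{red}(\nu^{-1}\gamma)\in\mathbb F_C$; $v$ is $C$-compatible with all elements of $\mathbb F_C(v)$; a subset of $\mathbb F_C(v)$ is $C$-compatible if its elements are pairwise $C$-compatible. $\mathcal X(v)$ is the set of nonempty finite lower $C$-compatible subsets of $\mathbb F_C(v)$; $\mathcal X=\bigsqcup_v\mathcal X(v)\sqcup\{0\}$ is a semilattice with $A\wedge B=A\cup B$ if $A,B\in\mathcal X(v)$ for some $v$ and $A\cup B$ is $C$-compatible, and $A\wedge B=0$ otherwise. $\mathcal Y=\mathcal X/{\sim}$, where $\sim$ is the congruence generated by $g^\downarrow\sim(gx^{-1})^\downarrow$ for $g\in\mathbb F_C$, $x\in E^1$ with $r(g)=r(x)$ and $gx^{-1}$ reduced ($g^\downarrow$ is the set of prefixes of $g$). (The semilattice $\mathcal Y$ is isomorphic to the idempotent semilattice of the inverse semigroup of $(E,C)$.) A filter of $\mathcal Y$ is a nonempty subset of $\mathcal Y\setminus\{0\}$ that is upward closed and closed under meets; an ultrafilter is a maximal filter. For $v\in E^0$, $\mathfrak F(v)$ is the set of all (possibly infinite) nonempty $C$-compatible lower subsets $Z$ of $\mathbb F_C(v)$ such that each $z\in Z$ can be extended to an element of $Z$ not ending in $E^{-1}$. $\mathfrak F=\bigsqcup_v\mathfrak F(v)$, ordered by inclusion, and $\mathfrak U$ is the set of maximal elements of $\mathfrak F$. *)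

(* Defs.v *)
From HB Require Import structures.
From mathcomp Require Import all_boot all_order generic_quotient.
From mathcomp Require Import boolp classical_sets functions cardinality.

Set Implicit Arguments.
Unset Strict Implicit.
Unset Printing Implicit Defensive.

Import Order.TTheory.

Local Open Scope classical_set_scope.

Record separated_graph := SeparatedGraph {
  vertex : Type;
  edge : Type;
  src : edge -> vertex;
  rng : edge -> vertex;
  sep : vertex -> set (set edge);
  sep_partition : forall v, partition (sep v) id [set e | src e = v] }.

Definition isolated (G : separated_graph) (v : vertex G) :=
  [set e | src e = v] = set0 :> set (edge G) /\
  [set e | rng e = v] = set0 :> set (edge G).

Section Paths.
Variable G : separated_graph.

(* [inl e] is the edge [e], [inr e] is its formal inverse. *)
Definition letter := (edge G + edge G)%type.

Definition lsrc (y : letter) : vertex G :=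
  match y with inl e => src e | inr e => rng e end.

Definition lrng (y : letter) : vertex G :=
  match y with inl e => rng e | inr e => src e end.

Definition linv (y : letter) : letter :=
  match y with inl e => inr e | inr e => inl e end.

(* [(v, w)] stands for the path with source [v] and letters [w]; it is the
   vertex [v] when [w] is empty.  Only those satisfying [is_path] are paths. *)
Definition word := (vertex G * seq letter)%type.

Fixpoint composable (v : vertex G) (w : seq letter) : Prop :=
  if w is y :: w' then lsrc y = v /\ composable (lrng y) w' else True.

Definition is_path (p : word) : Prop := composable p.1 p.2.

Definition psrc (p : word) : vertex G := p.1.

Definition prng (p : word) : vertex G := last p.1 (map lrng p.2).

Definition pinv (p : word) : word := (prng p, rev (map linv p.2)).

Definition pcat (p q : word) : word := (p.1, p.2 ++ q.2).

Definition pvertex (v : vertex G) : word := (v, [::]).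

Definition pedge_inv (x : edge G) : word := (rng x, [:: inr x]).

Definition subword (u w : seq letter) : Prop :=
  exists w1 w2, w = w1 ++ u ++ w2.

Definition reduced (p : word) : Prop :=
  is_path p /\ forall x : letter, ~ subword [:: x; linv x] p.2.

(* [red_cons x w] reduces [x :: w] when [w] is reduced, so folding it computes
   the unique normal form for the rewriting [x x^-1 -> s(x)]. *)
Definition red_cons (x : letter) (w : seq letter) : seq letter :=
  if w is y :: w' then if `[< y = linv x >] then w' else x :: w else [:: x].

Definition red (p : word) : word := (p.1, foldr red_cons [::] p.2).

Definition FC : set word := [set p | reduced p /\
  forall v (X : set (edge G)) x y, sep v X -> X x -> X y ->
    ~ subword [:: inr x; inl y] p.2].

Definition FCv (v : vertex G) : set word := [set p | FC p /\ psrc p = v].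

Definition prefix_le (p q : word) : Prop :=
  p.1 = q.1 /\ exists u, q.2 = p.2 ++ u.

Definition down (g : word) : set word := [set p | prefix_le p g].

Definition ends_in_inverse (p : word) : Prop :=
  exists w e, p.2 = rcons w (inr e).

Definition compatible_pair (v : vertex G) (p q : word) : Prop :=
  [\/ p = pvertex v, q = pvertex v | FC (red (pcat (pinv q) p))].

Definition compatible (v : vertex G) (A : set word) : Prop :=
  forall p q, A p -> A q -> compatible_pair v p q.

Definition lower (v : vertex G) (A : set word) : Prop :=
  forall p q, A q -> FCv v p -> prefix_le p q -> A p.

Definition calX (v : vertex G) : set (set word) := [set A |
  [/\ A !=set0, finite_set A, A `<=` FCv v, lower v A & compatible v A]].

Definition frakFv (v : vertex G) : set (set word) := [set Z |
  [/\ Z !=set0, Z `<=` FCv v, lower v Z, compatible v Z &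
   forall z, Z z -> exists z', [/\ Z z', prefix_le z z' & ~ ends_in_inverse z']]].

(* The [calX v] are pairwise disjoint (as are the [frakFv v]), since their
   elements are nonempty sets of paths with source [v]: a plain union suffices. *)
Definition frakF : set (set word) := \bigcup_v frakFv v.

Definition Xelt := {A : set word | exists v, calX v A}.

HB.instance Definition _ := gen_eqMixin Xelt.
HB.instance Definition _ := gen_choiceMixin Xelt.

(* [None] is the zero of the semilattice [meetX]. *)
Definition Xsl := option Xelt.

Definition meetable (A B : set word) : Prop :=
  exists v, [/\ calX v A, calX v B & compatible v (A `|` B)].

Lemma calX_setU A B : meetable A B -> exists v, calX v (A `|` B).
Proof.
move=> [v [[[a Aa] fA sA lA cA] [B0 fB sB lB cB] cAB]].
exists v; split => //.
- by exists a; left.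
- by rewrite finite_setU.
- by move=> p [/sA|/sB].
- by move=> p q [Aq|Bq] vp pq; [left; exact: (lA p q)|right; exact: (lB p q)].
Qed.

Definition meetX (a b : Xsl) : Xsl :=
  match a, b with
  | Some A, Some B =>
    match pselect (meetable (sval A) (sval B)) with
    | left AB => Some (exist _ (sval A `|` sval B) (calX_setU AB))
    | right _ => None
    end
  | _, _ => None
  end.

(* In [congX_gen], [down g] and [down (g x^-1)] always are elements of [Xelt];
   quantifying over [A] and [B] only spares their membership proofs. *)
Inductive congX : Xsl -> Xsl -> Prop :=
| congX_gen (g : word) (x : edge G) (A B : Xelt) :
    FC g -> prng g = rng x -> reduced (pcat g (pedge_inv x)) ->
    sval A = down g -> sval B = down (pcat g (pedge_inv x)) ->
    congX (Some A) (Some B)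
| congX_refl a : congX a a
| congX_sym a b : congX a b -> congX b a
| congX_trans a b c : congX a b -> congX b c -> congX a c
| congX_meet a b c d : congX a b -> congX c d -> congX (meetX a c) (meetX b d).

Lemma calX_src u v A : calX u A -> calX v A -> u = v.
Proof.
move=> [[p Ap] _ sA _ _] [_ _ sA' _ _].
by case: (sA _ Ap) (sA' _ Ap) => _ <- [_ <-].
Qed.

Lemma Xelt_inj (A B : Xelt) : sval A = sval B -> A = B.
Proof.
by move: A B => [A pA] [B pB] /= AB; subst B; rewrite (Prop_irrelevance pA pB).
Qed.

Lemma meetX_SomeP (A B C : Xelt) :
  meetX (Some A) (Some B) = Some C <->
  meetable (sval A) (sval B) /\ sval C = sval A `|` sval B.
Proof.
rewrite /meetX; case: pselect => [AB|nAB]; last by split=> // -[].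
by split=> [[<-]//|[_ CE]]; congr Some; exact: Xelt_inj.
Qed.

Lemma meetXC : commutative meetX.
Proof.
have mC A B : meetable A B -> meetable B A.
  by move=> [v [XA XB cAB]]; exists v; split; rewrite // setUC.
move=> [A|] [B|] //; case AB : (meetX (Some A) (Some B)) => [C|].
  have [mAB CE] := (meetX_SomeP A B C).1 AB.
  by apply/esym/meetX_SomeP; split; [exact: mC|rewrite setUC].
case BA : (meetX (Some B) (Some A)) => [C|//].
have [mBA CE] := (meetX_SomeP B A C).1 BA.
rewrite -AB; apply/meetX_SomeP; split; [exact: mC|by rewrite setUC].
Qed.

Lemma meetXX : idempotent_op meetX.
Proof.
move=> [A|] //; apply/meetX_SomeP; rewrite setUid; split=> //.
have [v XA] := svalP A; exists v; split; rewrite ?setUid//.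
by case: XA.
Qed.

Lemma compatibleS v A B : A `<=` B -> compatible v B -> compatible v A.
Proof. by move=> AB cB p q /AB Bp /AB Bq; exact: cB. Qed.

Lemma meetXA_sub (A B C D : Xelt) :
  meetX (Some A) (meetX (Some B) (Some C)) = Some D ->
  meetX (meetX (Some A) (Some B)) (Some C) = Some D.
Proof.
case BC : (meetX (Some B) (Some C)) => [E|//] /meetX_SomeP[[v [XA XE cAE]] DE].
have [[u [XB XC cBC]] EE] := (meetX_SomeP B C E).1 BC.
have uE : calX u (sval E).
  rewrite EE; have [w Xw] := calX_setU (ex_intro _ u (And3 XB XC cBC)).
  suff -> : u = w by [].
  have [[[p Bp] _ sB _ _] [_ _ sU _ _]] := (XB, Xw).
  by have [_ <-] := sB _ Bp; have [_ <-] := sU _ (or_introl Bp : (_ `|` _) p).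
have uv := calX_src uE XE; subst u.
have mAB : meetable (sval A) (sval B).
  exists v; split=> //; apply: compatibleS cAE; rewrite EE => p [Ap|Bp].
    by left.
  by right; left.
have [w XAB] := calX_setU mAB.
have wv : w = v.
  have [[[p Ap] _ sA _ _] [_ _ sU _ _]] := (XA, XAB).
  by have [_ <-] := sA _ Ap; have [_ <-] := sU _ (or_introl Ap : (_ `|` _) p).
subst w; pose F : Xelt := exist _ _ (ex_intro _ v XAB).
have -> : meetX (Some A) (Some B) = Some F by exact/meetX_SomeP.
apply/meetX_SomeP; split; last by rewrite DE EE setUA.
by exists v; split=> //=; rewrite -setUA -EE.
Qed.

Lemma meetXA : associative meetX.
Proof.
have sub A B C D : meetX A (meetX B C) = Some D -> meetX (meetX A B) C = Some D.
  by move: A B C => [A|] [B|] [C|] //; exact: meetXA_sub.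
move=> a b c; case L : (meetX a (meetX b c)) => [D|]; first by rewrite (sub _ _ _ _ L).
case R : (meetX (meetX a b) c) => [D|//].
by rewrite -L meetXC (meetXC b); apply: sub; rewrite meetXC (meetXC b).
Qed.

Definition congXb (a b : Xsl) : bool := `[< congX a b >].

Lemma congXb_refl : reflexive congXb.
Proof. by move=> a; apply/asboolP; exact: congX_refl. Qed.

Lemma congXb_sym : symmetric congXb.
Proof. by move=> a b; apply/asboolP/asboolP; exact: congX_sym. Qed.

Lemma congXb_trans : transitive congXb.
Proof.
by move=> b a c /asboolP ab /asboolP bc; apply/asboolP; exact: congX_trans bc.
Qed.

Canonical congX_equiv := EquivRel congXb congXb_refl congXb_sym congXb_trans.

Local Open Scope quotient_scope.

Definition calY := {eq_quot congX_equiv}.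

HB.instance Definition _ := Choice.on calY.
HB.instance Definition _ := EqQuotient.on calY.

Definition meetY : calY -> calY -> calY := lift_op2 calY meetX.

Lemma pi_meetX : {morph \pi_calY : a b / meetX a b >-> meetY a b}.
Proof.
have reprP a : congX a (repr (\pi_calY a)).
  by apply/(asboolP (congX _ _))/(@eqmodP _ congX_equiv); rewrite reprK.
move=> a b; unlock meetY; apply/(@eqmodP _ congX_equiv)/(asboolP (congX _ _)).
exact: congX_meet.
Qed.

Lemma meetYC : commutative meetY.
Proof. by elim/quotW=> a; elim/quotW=> b; rewrite -!pi_meetX meetXC. Qed.

Lemma meetYA : associative meetY.
Proof.
by elim/quotW=> a; elim/quotW=> b; elim/quotW=> c; rewrite -!pi_meetX meetXA.
Qed.

Lemma meetYY : idempotent_op meetY.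
Proof. by elim/quotW=> a; rewrite -pi_meetX meetXX. Qed.

Definition leY (a b : calY) : bool := meetY a b == a.

Lemma leY_refl : reflexive leY.
Proof. by move=> a; rewrite /leY meetYY. Qed.

Lemma leY_anti : antisymmetric leY.
Proof. by move=> a b /andP[/eqP ab /eqP ba]; rewrite -ab meetYC ba. Qed.

Lemma leY_trans : transitive leY.
Proof.
by move=> b a c /eqP ab /eqP bc; rewrite /leY -ab -meetYA bc.
Qed.

Fact calY_display : Order.disp_t. Proof. exact: Order.Disp tt tt. Qed.

HB.instance Definition _ := Order.Le_isPOrder.Build
  calY_display calY leY_refl leY_anti leY_trans.

HB.instance Definition _ := Order.POrder_Meet_isSemilattice.Build
  calY_display calY meetYC meetYA (fun a b : calY => erefl).

Definition zeroY : calY := \pi_calY None.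

Lemma le0Y (a : calY) : (zeroY <= a)%O.
Proof. by apply/eqP; elim/quotW: a => a; rewrite -pi_meetX. Qed.

HB.instance Definition _ :=
  Order.hasBottom.Build calY_display calY le0Y.

End Paths.
Arguments frakF G _ : clear implicits.

(* A proper filter: it avoids the bottom element. *)
Definition is_filter d (L : bMeetSemilatticeType d) (F : set L) : Prop :=
  [/\ F !=set0, ~ F \bot%O,
      forall a b, F a -> (a <= b)%O -> F b &
      forall a b, F a -> F b -> F (Order.meet a b)].

Definition maximal_elements T (S : set (set T)) : set (set T) :=
  [set A | S A /\ forall B, S B -> A `<=` B -> B = A].

Definition filters d (L : bMeetSemilatticeType d) : set (set L) :=
  [set F | is_filter F].
Arguments filters {d} L _.

Definition ultrafilters d (L : bMeetSemilatticeType d) : set (set L) :=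
  maximal_elements (filters L).
Arguments ultrafilters {d} L _.

Definition frakU (G : separated_graph) : set (set (word G)) :=
  maximal_elements (frakF G).
Arguments frakU G _ : clear implicits.

(* Main.v *)
Require Import Defs.
From mathcomp Require Import all_boot all_order generic_quotient.
From mathcomp Require Import boolp classical_sets functions cardinality.

(** A finite lower set [A] may lose its trailing inverse letters without changing
    its class: [trim A] keeps the words of [A] that extend, inside [A], to a
    word not ending in an inverse edge.  The proof rests on the fact that
    [trim A] is a complete invariant of the class of [A] ([congXP]), so that the
    nonzero part of the semilattice becomes a poset of finite sets ordered by
    reverse inclusion of their trimmings ([le_clsP]).

    That [trim] is constant on classes requires that it also detects whether a
    meet is zero.  This holds because a word [g] compatible with [h] stays
    compatible with [h] when an inverse letter [x^-1] is appended to [g]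
    ([compatible_pair_rcons]): in [red (h^-1 g)] the new letter either cancels
    the last one, or comes at the end, where it cannot create a subword
    [e^-1 f].  Hence a union is compatible as soon as its trimming is
    ([compatible_trim]).  Conversely [A] is congruent to [trim A], since [A] is
    obtained from [trim A] by meeting with finitely many principal lower sets
    [down g], [g] in [A], and each of these is absorbed after peeling the
    trailing inverse letters off [g] one by one ([congX_Some_trim]).

    A filter [F] is then sent to the union [support F] of the trimmings of its
    members, and [Z] in [frakF] to the set [filter_of Z] of the classes whose
    trimming lies in [Z].  The condition that every word of [Z] extends in [Z]
    to one not ending in an inverse says exactly that [Z] is a union of trimmed
    finite lower sets, which gives [filter_ofK].  In the other direction
    ([supportK]) a trimming is finite, so if it is covered by the members of a
    filter it is covered by a single one.  Both maps preserve inclusion, and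
    an order isomorphism preserves maximal elements. *)

Set Implicit Arguments.
Unset Strict Implicit.
Unset Printing Implicit Defensive.

Import Order.LTheory.

Local Open Scope classical_set_scope.

(** * Separated words and reduction of quotients *)

Section Words.
Variable G : separated_graph.
Implicit Types (a b : letter G) (p q u w : seq (letter G)) (v : vertex G).

Lemma linvK : involutive (@linv G).
Proof. by case. Qed.

(** Being reduced and being separated both forbid patterns of two consecutive
    letters only, so together they say that a word is [sorted] for this
    relation ([FCE]). *)
Definition separated_step a b : bool :=
  `[< b <> linv a /\ forall v X x y, sep v X -> X x -> X y ->
       ~ (a = inr x /\ b = inl y) >].

Lemma separated_step_inv a b :
  separated_step (linv b) (linv a) = separated_step a b.
Proof.
apply/asboolP/asboolP => -[nab sepab]; split.
- by move=> ba; apply: nab; rewrite ba linvK.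
- move=> v X x y sX Xx Xy [ax by_]; apply: (sepab v X y x sX Xy Xx).
  by rewrite ax by_.
- by rewrite linvK => ab; apply: nab.
- move=> v X x y sX Xx Xy [bx ay]; apply: (sepab v X y x sX Xy Xx).
  by rewrite -[a]linvK -[b]linvK ay bx.
Qed.

(** The separation condition forbids [e^-1 f] only, so cancellation is the one
    obstruction to appending an inverse letter. *)
Lemma separated_step_inr a x : a <> inl x -> separated_step a (inr x).
Proof.
move=> ax; apply/asboolP; split; last by move=> ? ? ? ? _ _ _ [_].
by move=> xa; apply: ax; rewrite -[a]linvK -xa.
Qed.

Lemma sorted_subwordP (e : rel (letter G)) w :
  sorted e w <-> forall a b, subword [:: a; b] w -> e a b.
Proof.
split=> [sw a b [w1 [w2 E]]|].
  by move: sw; rewrite E => /cat_sorted2[_] /= /andP[].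
elim: w => [|a [|b w] IH] //= H; apply/andP; split.
  by apply: H; exists [::], w.
apply: IH => c d [w1 [w2 E]]; apply: H.
by exists (a :: w1), w2; rewrite /= E.
Qed.

Lemma FCE v w : FC (v, w) <-> composable v w /\ sorted separated_step w.
Proof.
rewrite sorted_subwordP; split=> [[[vw rw] sw]|[vw H]].
  split=> // a b ab; apply/asboolP; split.
    by move=> ba; apply: (rw a); rewrite -ba.
  move=> u X x y sX Xx Xy [ax by_]; apply: (sw u X x y sX Xx Xy).
  by rewrite -ax -by_.
split; first by split=> // x /H/asboolP[].
by move=> u X x y sX Xx Xy /H/asboolP[_ /(_ u X x y sX Xx Xy)]; apply.
Qed.

Lemma composable_cat v p q : composable v (p ++ q) <->
  composable v p /\ composable (last v (map (@lrng G) p)) q.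
Proof. by elim: p v => [|a p IH] v /=; [|rewrite IH]; tauto. Qed.

Lemma FC_cat v p q : FC (v, p ++ q) -> FC (v, p).
Proof. by rewrite !FCE => -[/composable_cat[? _] /cat_sorted2[]]. Qed.

Lemma sorted_rev_inv w :
  sorted separated_step (rev (map (@linv G) w)) = sorted separated_step w.
Proof.
rewrite rev_sorted sorted_map; apply: eq_sorted => a b /=.
exact: separated_step_inv.
Qed.

(** The reduction of [q^-1 p] for reduced [p]: the letters of [q^-1] are absorbed
    by [p] one at a time, from the first letter of [q] on. *)
Definition quot p q := foldl (fun w y => red_cons (linv y) w) p q.
Arguments quot : simpl never.

Lemma red_cons_sorted a w : sorted separated_step (a :: w) ->
  red_cons a w = a :: w.
Proof. by case: w => //= b w /andP[/asboolP[ab _] _]; case: asboolP. Qed.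

Lemma foldr_red_cons_sorted w : sorted separated_step w ->
  foldr (@red_cons G) [::] w = w.
Proof.
elim: w => //= a w IH aw; rewrite IH ?red_cons_sorted//.
exact: path_sorted aw.
Qed.

Lemma red_pinv_pcat v p q : sorted separated_step p ->
  red (pcat (Defs.pinv (v, q)) (v, p)) = (prng (v, q), quot p q).
Proof.
move=> sp; rewrite /red /= foldr_cat foldr_red_cons_sorted//.
rewrite -(foldl_rev (fun w a => red_cons a w)) revK.
by congr pair; elim: q p {sp} => //= a q IH p; exact: IH.
Qed.

Lemma quot_cons a p q : quot (a :: p) (a :: q) = quot p q.
Proof. by rewrite /quot /= linvK; case: asboolP. Qed.

Lemma composable_quot v p q : composable v p -> composable v q ->
  composable (prng (v, q)) (quot p q).
Proof.
elim: q v p => [|a q IH] v p //= vp [av aq].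
apply: (IH (lrng a)) => //; rewrite /red_cons.
have la : lsrc (linv a) = lrng a by case: (a).
have ra : lrng (linv a) = lsrc a by case: (a).
case: p vp => [|b p] //= [bv bp].
case: asboolP => [|_] /=; last by rewrite la ra bv av.
by rewrite linvK => <-.
Qed.

(** Nothing cancels when [p] and [q] have no common first letter. *)
Lemma quot_rev p q : sorted separated_step q ->
  (forall a p' q', p = a :: p' -> q <> a :: q') ->
  quot p q = rev (map (@linv G) q) ++ p.
Proof.
case: q => [//|b q] sq ndiff.
have -> : quot p (b :: q) = quot (linv b :: p) q.
  rewrite /quot /=; congr foldl; case: p ndiff => //= a p /(_ a p q erefl) ndiff.
  by case: asboolP => //; rewrite linvK => ab; case: ndiff; rewrite ab.
(* After the first step [q] is consumed with no cancellation at all, as it is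
   reduced. *)
elim: q b p {ndiff} sq => [//|c q IH] b p sq.
have /andP[/asboolP[bc _] sq'] := sq.
have -> : quot (linv b :: p) (c :: q) = quot (linv c :: linv b :: p) q.
  rewrite /quot /=; case: asboolP => //; rewrite linvK => cb.
  by case: bc.
by rewrite IH// [in RHS]/= rev_cons cat_rcons.
Qed.

Lemma quot_nil q : sorted separated_step q -> quot [::] q = rev (map (@linv G) q).
Proof. by move=> sq; rewrite quot_rev ?cats0. Qed.

(** Induction on the longest common prefix of [p] and [q], the part that cancels
    in [q^-1 p]. *)
Lemma quot_ind (P : seq (letter G) -> seq (letter G) -> Prop) :
  (forall p q, (forall a p' q', p = a :: p' -> q <> a :: q') -> P p q) ->
  (forall a p q, P p q -> P (a :: p) (a :: q)) ->
  forall p q, P p q.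
Proof.
move=> Pd Pc; elim=> [|a p IH] [|b q]; try by apply: Pd.
have [ab|ab] := EM (a = b); first by rewrite ab; exact: Pc.
by apply: Pd => c p' q' [<- _] [ba _]; apply: ab.
Qed.

Lemma quot_inv p q : sorted separated_step p -> sorted separated_step q ->
  quot q p = rev (map (@linv G) (quot p q)).
Proof.
move: p q; apply: quot_ind => [p q pq sp sq|a p q IH sp sq].
  rewrite (quot_rev sq pq) (quot_rev sp) => [|a p' q' qa pa]; last first.
    exact: (pq a q' p').
  by rewrite map_cat rev_cat map_rev revK mapK//; exact: linvK.
by rewrite !quot_cons IH//; [exact: path_sorted sp|exact: path_sorted sq].
Qed.

(** Past the common prefix, either [q] starts with the new letter [x^-1], which
    then cancels and leaves a piece of [q^-1], or [x^-1] becomes the last letter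
    of the quotient, where it cannot follow the letter [x]. *)
Lemma sorted_quot_rcons p q x :
  sorted separated_step (rcons p (inr x)) -> sorted separated_step q ->
  sorted separated_step (quot p q) ->
  sorted separated_step (quot (rcons p (inr x)) q).
Proof.
move: p q; apply: quot_ind => [p q pq|a p q IH]; last first.
  rewrite /= !quot_cons => /path_sorted sp /path_sorted sq; exact: IH.
case: p pq => [|a p] pq sp sq spq.
- case: q sq spq {pq} => [|b q] //= sq spq.
  (* [p] is a prefix of [q], and [b] is the next letter of [q]. *)
  have [xb|xb] := EM (b = inr x).
    by rewrite xb quot_cons quot_nil ?sorted_rev_inv//; exact: path_sorted sq.
  rewrite quot_rev//; last by move=> c p' q' [<- _] [].
  rewrite map_cons rev_cons cat_rcons sorted_cat_cons -rev_cons -map_cons.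
  rewrite sorted_rev_inv /= sq andbT; apply: separated_step_inr => bx.
  by apply: xb; rewrite -[b]linvK bx.
- have pq' : forall c p' q', rcons (a :: p) (inr x) = c :: p' -> q <> c :: q'.
    by move=> c p' q' [<- _]; exact: (pq a p).
  rewrite quot_rev// in spq; rewrite quot_rev//= sorted_cat_cons.
  by move: spq; rewrite sorted_cat_cons => /andP[-> _].
Qed.

(** Composability of the reduced quotient is automatic, and the two vertex cases
    of [compatible_pair] are not exceptions: then the quotient is [p] or
    [q^-1]. *)
Lemma compatible_pairE v p q : FC (v, p) -> FC (v, q) ->
  compatible_pair v (v, p) (v, q) <-> sorted separated_step (quot p q).
Proof.
move=> /FCE[vp sp] /FCE[vq sq].
have FCq : FC (red (pcat (Defs.pinv (v, q)) (v, p))) <->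
    sorted separated_step (quot p q).
  rewrite red_pinv_pcat// FCE; split=> [[]//|spq].
  by split=> //; exact: composable_quot.
split=> [[[p0]|[q0]|/FCq//]|/FCq]; last exact: Or33.
  by rewrite p0 quot_nil ?sorted_rev_inv.
by rewrite q0.
Qed.

Lemma compatible_pair_sym v g h : FCv v g -> FCv v h ->
  compatible_pair v g h -> compatible_pair v h g.
Proof.
case: g h => v1 p [v2 q] [Fp /= v1E] [Fq /= v2E]; subst v1 v2.
rewrite !compatible_pairE// (@quot_inv p) ?sorted_rev_inv//.
  by move/FCE: Fp => [].
by move/FCE: Fq => [].
Qed.

Lemma compatible_pair_rcons v p x h :
  FCv v (v, rcons p (inr x)) -> FCv v h ->
  compatible_pair v (v, p) h -> compatible_pair v (v, rcons p (inr x)) h.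
Proof.
case: h => u q [Fpx _] [Fq /= uE]; subst u.
have Fp : FC (v, p) by apply: (@FC_cat _ _ [:: inr x]); rewrite cats1.
rewrite !compatible_pairE//; apply: sorted_quot_rcons.
  by case/FCE: Fpx.
by case/FCE: Fq.
Qed.

(** * Principal lower sets *)

Lemma prefix_le_refl (g : word G) : prefix_le g g.
Proof. by split=> //; exists [::]; rewrite cats0. Qed.

Lemma prefix_le_trans (h g k : word G) :
  prefix_le g h -> prefix_le h k -> prefix_le g k.
Proof.
move=> [gh [u hu]] [hk [w kw]]; split; first by rewrite gh.
by exists (u ++ w); rewrite kw hu catA.
Qed.

Lemma prefix_FCv v (g h : word G) : prefix_le g h -> FCv v h -> FCv v g.
Proof.
case: g h => [v1 p] [v2 q] [/= -> [u ->]] [Fq /= v2v]; split=> //.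
exact: FC_cat Fq.
Qed.

Lemma compatible_prefix v (g h : word G) : FCv v h -> prefix_le g h ->
  compatible_pair v g h.
Proof.
move=> vh gh; have vg := prefix_FCv gh vh.
apply: compatible_pair_sym => //.
case: g h gh vh vg => [v1 p] [v2 q] [/= _ [u ->]] [Fq /= qE] [Fp /= pE].
subst v1 v2.
rewrite compatible_pairE//.
suff -> : quot (p ++ u) p = u by move/FCE: Fq => [_ /cat_sorted2[]].
by elim: p {Fp Fq} => //= a p; rewrite quot_cons.
Qed.

Lemma down_rcons v p a :
  Defs.down (v, rcons p a) = Defs.down (v, p) `|` [set (v, rcons p a)].
Proof.
apply/seteqP; split=> -[v' q] /=; last first.
  move=> [|->]; last exact: prefix_le_refl.
  move/prefix_le_trans; apply.
  by split=> //; exists [:: a]; rewrite cats1.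
move=> [/= -> [u]]; case/lastP: u => [|u b].
  by rewrite cats0 => <-; right.
rewrite -rcons_cat => /rcons_inj[-> _]; left.
by split=> //; exists u.
Qed.

Lemma down_nil v : Defs.down (v, [::]) = [set pvertex v].
Proof.
apply/seteqP; split=> [[v' q] [/= -> [u]]|_ ->]; last exact: prefix_le_refl.
by case: q.
Qed.

Lemma calX_down v g : FCv v g -> calX v (Defs.down g).
Proof.
move=> vg; split.
- by exists g; exact: prefix_le_refl.
- case: g {vg} => u p; elim/last_ind: p => [|p a IH].
    by rewrite down_nil; exact: finite_set1.
  by rewrite down_rcons finite_setU; split=> //; exact: finite_set1.
- by move=> h hg; exact: prefix_FCv vg.
- by move=> h k kg _ hk; exact: prefix_le_trans kg.
- move=> h k hg kg.
  have vh := prefix_FCv hg vg; have vk := prefix_FCv kg vg.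
  suff [hk|kh] : prefix_le h k \/ prefix_le k h.
  + exact: compatible_prefix.
  + by apply: compatible_pair_sym => //; exact: compatible_prefix.
  case: h k g hg kg {vg vh vk} => [v1 p] [v2 q] [v3 w] [/= -> [u ->]] [/= -> [t]].
  rewrite /prefix_le /=; elim: p q => [|a p IH] [|b q] //=.
  + by left; split=> //; exists [::].
  + by left; split=> //; exists (b :: q).
  + by right; split=> //; exists (a :: p).
  + move=> [-> /IH] [[_ [s ->]]|[_ [s ->]]]; [left|right]; split=> //; by exists s.
Qed.

Lemma FCv_pvertex v : FCv v (pvertex v).
Proof. by split=> //; apply/FCE. Qed.

Lemma lower_pvertex v A : A !=set0 -> A `<=` FCv v -> lower v A -> A (pvertex v).
Proof.
move=> [g Ag] /(_ _ Ag)[Fg gv] lA; apply: (lA _ g) => //; first exact: FCv_pvertex.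
by split=> //; exists g.2.
Qed.

Lemma not_ends_in_inverse_pvertex v : ~ ends_in_inverse (pvertex v).
Proof. by move=> [[|? ?] [e]]. Qed.

End Words.

(** * Trimming trailing inverse letters *)

Lemma finite_set_ind (T : Type) (A : set T) (P : set T -> Prop) :
  P set0 ->
  (forall B x, B `<=` A -> A x -> P B -> P (x |` B)) ->
  finite_set A -> P A.
Proof.
move=> P0 PU /(@finite_seqP {classic T})[s AE].
suff H : forall r : seq {classic T}, [set` r] `<=` A -> P [set` r].
  by rewrite AE; apply: H; rewrite AE.
elim=> [_|x r IH]; first by rewrite set_nil.
have -> : [set` x :: r] = x |` [set` r] :> set {classic T}.
  apply/seteqP; split=> y /=; rewrite in_cons.
    by case/orP=> [/eqP|]; [left|right].
  by move=> [->|yr]; rewrite ?eqxx// yr orbT.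
by rewrite subUset => -[xA rA]; apply: PU => //; [exact: xA|exact: IH].
Qed.

Section Trim.
Variable G : separated_graph.
Implicit Types (v : vertex G) (Z : set (word G)).

Definition trim A : set (word G) :=
  [set p | exists q, [/\ A q, prefix_le p q & ~ ends_in_inverse q]].

Lemma trimU A B : trim (A `|` B) = trim A `|` trim B.
Proof.
apply/seteqP; split=> p.
  by move=> [q [[Aq|Bq] pq nq]]; [left|right]; exists q.
by move=> [|] [q [Aq pq nq]]; exists q; split=> //; [left|right].
Qed.

Lemma lower_prefix v A p q : A `<=` FCv v -> lower v A -> A q ->
  prefix_le p q -> A p.
Proof. by move=> sA lA Aq pq; apply: (lA p q) => //; exact: prefix_FCv (sA _ Aq). Qed.

Lemma trim_sub v A : A `<=` FCv v -> lower v A -> trim A `<=` A.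
Proof. by move=> sA lA p [q [Aq pq _]]; exact: lower_prefix sA lA Aq pq. Qed.

Lemma trim_pvertex v A : A (pvertex v) -> trim A (pvertex v).
Proof.
move=> Av; exists (pvertex v); split=> //; first exact: prefix_le_refl.
exact: not_ends_in_inverse_pvertex.
Qed.

Lemma sub_calX v A B : calX v A -> B !=set0 -> B `<=` A -> lower v B -> calX v B.
Proof.
move=> [_ fA sA lA cA] B0 BA lB; split=> //.
- exact: sub_finite_set fA.
- by move=> p /BA/sA.
- exact: compatibleS cA.
Qed.

Lemma calX_pvertex v A : calX v A -> A (pvertex v).
Proof. by move=> [A0 _ sA lA _]; exact: lower_pvertex. Qed.

Lemma calX_trim_sub v A : calX v A -> trim A `<=` A.
Proof. by move=> [_ _ sA lA _]; exact: trim_sub sA lA. Qed.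

Lemma calX_trim v A : calX v A -> calX v (trim A).
Proof.
move=> XA; apply: (sub_calX XA).
- by exists (pvertex v); exact: (trim_pvertex (calX_pvertex XA)).
- exact: calX_trim_sub XA.
- by move=> p q [r [Ar qr nr]] _ pq; exists r; split=> //; exact: (prefix_le_trans pq qr).
Qed.

Lemma calX_trim_src u v A B : calX u A -> calX v B -> trim A `<=` trim B -> u = v.
Proof.
move=> XA XB AB.
have /AB/(calX_trim_sub XB) := trim_pvertex (calX_pvertex XA).
by case: XB => _ _ sB _ _ /sB[_].
Qed.

(** Every word of a lower set [U] arises from a word of [trim U] by appending
    inverse letters while staying in [U]. *)
Lemma trim_ind v U (P : word G -> Prop) : U `<=` FCv v -> lower v U ->
  (forall g, trim U g -> P g) ->
  (forall p x, U (v, p) -> U (v, rcons p (inr x)) -> P (v, p) ->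
     P (v, rcons p (inr x))) ->
  forall g, U g -> P g.
Proof.
move=> sU lU Pt Pr [u p] Up; have [_ /= uv] := sU _ Up; subst u.
elim/last_ind: p Up => [|p a IH] Up.
  exact/Pt/trim_pvertex.
have [[q [e /= /rcons_inj[_ ae]]]|ni] := EM (ends_in_inverse (v, rcons p a)).
  rewrite ae in Up *.
  have pU : U (v, p).
    have pp : prefix_le (v, p) (v, rcons p (inr e)).
      by split=> //; exists [:: inr e]; rewrite /= cats1.
    exact: lower_prefix sU lU Up pp.
  by apply: Pr => //; exact: IH.
by apply: Pt; exists (v, rcons p a); split=> //; exact: prefix_le_refl.
Qed.

Lemma compatible_trim v U : U `<=` FCv v -> lower v U ->
  compatible v (trim U) -> compatible v U.
Proof.
move=> sU lU ct.
have tU := trim_sub sU lU.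
have c1 g h : U g -> trim U h -> compatible_pair v g h.
  move=> + th; move: g; apply: (trim_ind sU lU) => [k tk|p x Up Upx].
    exact: ct.
  by apply: compatible_pair_rcons; apply: sU => //; exact: tU.
move=> h g Uh; move: g; apply: (trim_ind sU lU) => [k tk|p x Up Upx hp].
  exact: c1.
apply: compatible_pair_sym; try exact: sU.
apply: compatible_pair_rcons; try exact: sU.
by apply: compatible_pair_sym => //; exact: sU.
Qed.

Lemma meetable_trim v A B : calX v A -> calX v B ->
  compatible v (trim A `|` trim B) -> meetable A B.
Proof.
move=> XA XB cAB; exists v; split=> //.
have [_ _ sA lA _] := XA; have [_ _ sB lB _] := XB.
apply: compatible_trim; rewrite ?trimU//.
  by move=> p [/sA|/sB].
by move=> p q [Aq|Bq] vp pq; [left; exact: (lA p q)|right; exact: (lB p q)].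
Qed.

Lemma meetable_trim_sub A B C D :
  (exists v, calX v A) -> (exists v, calX v B) ->
  trim A `<=` trim C -> trim B `<=` trim D -> meetable C D -> meetable A B.
Proof.
move=> [u XA] [w XB] AC BD [v [XC XD cCD]].
have uv := calX_trim_src XA XC AC; have wv := calX_trim_src XB XD BD; subst u w.
apply: (meetable_trim XA XB); apply: compatibleS cCD.
by move=> p [/AC/(calX_trim_sub XC)|/BD/(calX_trim_sub XD)]; [left|right].
Qed.

(** * Trimmings classify the elements of the quotient *)

Definition trim_opt (a : Xsl G) : option (set (word G)) :=
  omap (fun A : Xelt G => trim (sval A)) a.

(** The two meets vanish together by [meetable_trim_sub], which is where the
    stability of compatibility under appended inverse letters is used. *)
Lemma trim_opt_meetX (a b c d : Xsl G) : trim_opt a = trim_opt b ->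
  trim_opt c = trim_opt d -> trim_opt (meetX a c) = trim_opt (meetX b d).
Proof.
move: a b c d => [A|] [B|] [C|] [D|] //= [AB] [CD].
case: pselect => [mAC|nAC]; case: pselect => [mBD|nBD] //=.
- by rewrite !trimU AB CD.
- case: nBD; apply: (meetable_trim_sub (svalP B) (svalP D) _ _ mAC).
    by rewrite AB.
  by rewrite CD.
- case: nAC; apply: (meetable_trim_sub (svalP A) (svalP C) _ _ mBD).
    by rewrite AB.
  by rewrite CD.
Qed.

Lemma congX_trim (a b : Xsl G) : congX a b -> trim_opt a = trim_opt b.
Proof.
elim=> {a b} [[v p] x A B _ _ _ AE BE|//|//||]; last 2 first.
- by move=> a b c _ -> _ ->.
- by move=> a b c d _ ab _ cd; exact: trim_opt_meetX.
rewrite /= AE BE /pcat /= cats1 down_rcons trimU; congr Some.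
apply/seteqP; split=> q; first by left.
by move=> [//|[r [-> _]]] []; exists p, x.
Qed.

(** The set [down g] is absorbed by any [X] that contains the trimming of [A]: by
    [trim_ind], [g] is shortened one inverse letter at a time, each step being
    a generator of the congruence met with [X], until [g] lies in [X]. *)
Lemma congX_meet_down v (A X Y : Xelt G) g : calX v (sval A) -> sval A g ->
  trim (sval A) `<=` sval X -> sval X `<=` sval A ->
  sval Y = sval X `|` Defs.down g -> congX (Some X) (Some Y).
Proof.
move=> XA; have [_ _ sA lA cA] := XA.
move=> Ag tAX XsA.
have vX : calX v (sval X).
  have [u Xu] := svalP X; suff <- : u = v by [].
  by have [_ <-] := sA _ (XsA _ (calX_pvertex Xu)).
have XUP (h : word G) : sval A h -> calX v (sval X `|` Defs.down h).
  move=> Ah; apply: (sub_calX XA).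
  - by exists h; right; exact: prefix_le_refl.
  - move=> k [/XsA//|kh]; exact: lower_prefix sA lA Ah kh.
  - move=> k l [Xl|lh] vk kl; last by right; exact: (prefix_le_trans kl lh).
    by left; case: vX => _ _ _ lX _; exact: lX kl.
have sub_down (h : word G) : sval A h -> sval X `|` Defs.down h `<=` sval A.
  by move=> Ah k [/XsA//|kh]; exact: lower_prefix sA lA Ah kh.
have meet_down (h : word G) (D Y' : Xelt G) : sval A h -> sval D = Defs.down h ->
    sval Y' = sval X `|` Defs.down h -> meetX (Some X) (Some D) = Some Y'.
  move=> Ah DE YE; apply/meetX_SomeP; rewrite DE; split=> //.
  exists v; split=> //; first exact/calX_down/sA.
  exact: compatibleS (sub_down _ Ah) cA.
move: g Ag Y; apply: (trim_ind sA lA) => [h th Y YE|p x Ap Apx IH Y YE].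
  suff -> : X = Y by exact: congX_refl.
  apply: Xelt_inj; rewrite YE; apply/esym/setUidl => k kh; apply: tAX.
  by case: th => r [Ar hr nr]; exists r; split=> //; exact: (prefix_le_trans kh hr).
pose D1 : Xelt G := exist _ _ (ex_intro _ v (calX_down (sA _ Ap))).
pose D2 : Xelt G := exist _ _ (ex_intro _ v (calX_down (sA _ Apx))).
pose Y1 : Xelt G := exist _ _ (ex_intro _ v (XUP _ Ap)).
apply: (congX_trans (IH Y1 erefl)).
rewrite -(meet_down _ D1 Y1 Ap)// -(meet_down _ D2 Y Apx)//.
apply: congX_meet; first exact: congX_refl.
have [Fp _] := sA _ Ap; have [Fpx _] := sA _ Apx.
have pxE : pcat (v, p) (pedge_inv x) = (v, rcons p (inr x)).
  by rewrite /pcat /= cats1.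
apply: (@congX_gen _ (v, p) x) => //; rewrite ?pxE//; last by case: Fpx.
by case: Fpx => -[]; rewrite /is_path /= -cats1 composable_cat => -[_ [/esym]].
Qed.

(** [A] is the union of its trimming and of the finitely many [down g], [g] in
    [A]; these are adjoined one by one. *)
Lemma congX_Some_trim (A T : Xelt G) : sval T = trim (sval A) ->
  congX (Some T) (Some A).
Proof.
have [v XA] := svalP A; have [_ fA sA lA _] := XA => TE.
have tA := calX_trim_sub XA; have [T0 _ _ lT _] := calX_trim XA.
(* The partial union attached to a finite subset [S] of [A]. *)
pose below (S : set (word G)) := [set p | exists2 q, S q & prefix_le p q].
have belowA : trim (sval A) `|` below (sval A) = sval A.
  apply/seteqP; split=> [p [/tA//|[q Aq pq]]|p Ap].
    exact: (lower_prefix sA lA Aq pq).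
  by right; exists p => //; exact: prefix_le_refl.
suff H : forall Y : Xelt G, sval Y = trim (sval A) `|` below (sval A) ->
    congX (Some T) (Some Y) by apply: H; rewrite belowA.
pattern (sval A) at 2; apply: finite_set_ind fA => [Y YE|S g SA Ag IH Y YE].
  suff -> : T = Y by exact: congX_refl.
  by apply: Xelt_inj; rewrite TE YE; apply/seteqP; split=> [p|p [//|[]//]]; left.
have BA : trim (sval A) `|` below S `<=` sval A.
  move=> p [/tA//|[q /SA Aq pq]]; exact: (lower_prefix sA lA Aq pq).
have XB : calX v (trim (sval A) `|` below S).
  apply: (sub_calX XA) => //.
    by case: T0 => t tT; exists t; left.
  move=> p q [tq|[r rs qr]] vp pq; first by left; exact: lT pq.
  by right; exists r => //; exact: (prefix_le_trans pq qr).
pose Z : Xelt G := exist _ _ (ex_intro _ v XB).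
apply: (congX_trans (IH Z erefl)).
apply: (@congX_meet_down v A Z Y g XA Ag) => //=.
rewrite YE -setUA; congr setU; apply/seteqP; split=> p.
  by move=> [q [->|Sq] pq]; [right|left; exists q].
by move=> [[q Sq pq]|pg]; [exists q => //; right|exists g => //; left].
Qed.

Lemma congXP (a b : Xsl G) : congX a b <-> trim_opt a = trim_opt b.
Proof.
split; first exact: congX_trim.
case: a b => [A|] [B|] //= => [[AB]|_]; last exact: congX_refl.
have [v XA] := svalP A.
pose T : Xelt G := exist _ _ (ex_intro _ v (calX_trim XA)).
apply: (congX_trans (congX_sym (congX_Some_trim (erefl (sval T))))).
by apply: congX_Some_trim; rewrite -AB.
Qed.

Local Open Scope quotient_scope.

Definition cls (A : Xelt G) : calY G := \pi_(calY G) (Some A).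

Lemma piP (a b : Xsl G) : \pi_(calY G) a = \pi_(calY G) b <->
  trim_opt a = trim_opt b.
Proof.
rewrite -congXP; split=> [/(@eqmodP _ (congX_equiv G))/(asboolP (congX _ _))//|ab].
exact/(@eqmodP _ (congX_equiv G))/(asboolP (congX _ _)).
Qed.

Lemma clsE (A B : Xelt G) : cls A = cls B <-> trim (sval A) = trim (sval B).
Proof. by rewrite piP /=; split=> [[]|->]. Qed.

Lemma cls_neq0 (A : Xelt G) : cls A <> \bot%O.
Proof. by move/piP. Qed.

Lemma calY_case (y : calY G) : y = \bot%O \/ exists A : Xelt G, y = cls A.
Proof.
elim/quotW: y => -[A|]; [right|left => //]; by exists A.
Qed.

Lemma meet_cls (A B : Xelt G) :
  Order.meet (cls A) (cls B) = \pi_(calY G) (meetX (Some A) (Some B)).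
Proof. by rewrite pi_meetX. Qed.

Lemma meet_clsP (A B C : Xelt G) : Order.meet (cls A) (cls B) = cls C <->
  meetable (sval A) (sval B) /\ trim (sval C) = trim (sval A) `|` trim (sval B).
Proof.
rewrite meet_cls piP /=; case: pselect => [mAB|nAB] /=; last by split=> // -[].
by rewrite trimU; split=> [[]//|[_ ->]].
Qed.

Lemma le_clsP (A B : Xelt G) :
  (cls A <= cls B)%O <-> trim (sval B) `<=` trim (sval A).
Proof.
rewrite leEmeet; split=> [/eqP/meet_clsP[_ AE]|BA].
  by rewrite AE; exact: subsetUr.
apply/eqP/meet_clsP; split; last exact/esym/setUidl.
apply: (meetable_trim_sub (svalP A) (svalP B) (@subset_refl _ _) BA).
have [v XA] := svalP A; exists v; split; rewrite ?setUid//.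
by case: XA.
Qed.

(** * Filters and maximal filters *)

Definition support (F : set (calY G)) : set (word G) :=
  [set p | exists A, F (cls A) /\ trim (sval A) p].

Definition filter_of Z : set (calY G) :=
  [set y | exists A, y = cls A /\ trim (sval A) `<=` Z].

Lemma filter_cls (F : set (calY G)) y : is_filter F -> F y ->
  exists A : Xelt G, y = cls A.
Proof. by move=> [_ F0 _ _]; case: (calY_case y) => // ->. Qed.

Lemma filter_meet (F : set (calY G)) (A B : Xelt G) : is_filter F ->
  F (cls A) -> F (cls B) -> exists C, F (cls C) /\
    meetable (sval A) (sval B) /\ trim (sval C) = trim (sval A) `|` trim (sval B).
Proof.
move=> fF FA FB; have [_ _ _ /(_ _ _ FA FB) Fm] := fF.
have [C CE] := filter_cls fF Fm.
by exists C; rewrite -CE; split=> //; exact/meet_clsP.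
Qed.

(** All members of [F] have the same source vertex and are pairwise compatible
    because their meets, being in [F], are nonzero. *)
Lemma frakF_support (F : set (calY G)) : is_filter F -> frakF G (support F).
Proof.
move=> fF; have [[y Fy] _ _ _] := fF; have [A AE] := filter_cls fF Fy; subst y.
have [v XA] := svalP A; exists v => //.
have calXF (B : Xelt G) : F (cls B) -> calX v (sval B).
  move=> FB; have [_ [_ [[u [XuA XuB _]] _]]] := filter_meet fF Fy FB.
  by rewrite (calX_src XA XuA).
split.
- by exists (pvertex v), A; split=> //; exact: (trim_pvertex (calX_pvertex XA)).
- move=> p [B [/calXF XB tBp]]; have [_ _ sB _ _] := XB.
  exact/sB/(calX_trim_sub XB).
- move=> p q [B [FB tBq]] vp pq; exists B; split=> //.
  by have [_ _ _ lT _] := calX_trim (calXF _ FB); exact: lT pq.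
- move=> p q [B [FB tBp]] [C [FC tCq]].
  have [_ [_ [[u [XB XC cBC]] _]]] := filter_meet fF FB FC.
  rewrite (calX_src (calXF _ FB) XB).
  apply: cBC; first by left; exact: (calX_trim_sub XB tBp).
  by right; exact: (calX_trim_sub XC tCq).
- move=> p [B [FB [q [Bq pq nq]]]]; exists q; split=> //.
  exists B; split=> //; exists q; split=> //; exact: prefix_le_refl.
Qed.

Lemma filter_of_filter Z : frakF G Z -> is_filter (filter_of Z).
Proof.
move=> [v _ [Z0 sZ lZ cZ eZ]].
have Zv := lower_pvertex Z0 sZ lZ.
have calXZ (A : Xelt G) : trim (sval A) `<=` Z -> calX v (sval A).
  have [u XA] := svalP A => /(_ _ (trim_pvertex (calX_pvertex XA)))/sZ[_ <-].
  exact: XA.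
split.
- pose V : Xelt G := exist _ _ (ex_intro _ v (calX_down (FCv_pvertex v))).
  exists (cls V), V; split=> // p /(calX_trim_sub (calX_down (FCv_pvertex v))).
  by rewrite down_nil => ->.
- by move=> [A [/esym/cls_neq0]].
- move=> _ b [A [-> AZ]]; have [->|[B ->]] := calY_case b.
    by rewrite lex0 => /eqP/cls_neq0.
  by move=> /le_clsP BA; exists B; split=> // p /BA/AZ.
- move=> _ _ [A [-> AZ]] [B [-> BZ]].
  have mAB : meetable (sval A) (sval B).
    apply: (meetable_trim (calXZ _ AZ) (calXZ _ BZ)); apply: compatibleS cZ.
    by move=> p [/AZ|/BZ].
  pose C : Xelt G := exist _ _ (calX_setU mAB).
  exists C; split; first by apply/meet_clsP; rewrite /= trimU.
  by rewrite /= trimU => p [/AZ|/BZ].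
Qed.

(** A word of [Z] belongs to [down z'] for some [z'] in [Z] not ending in an
    inverse, and [down z'] is its own trimming. *)
Lemma filter_ofK Z : frakF G Z -> support (filter_of Z) = Z.
Proof.
move=> [v _ [Z0 sZ lZ cZ eZ]]; apply/seteqP; split=> [p|z Zz].
  by move=> [A [[B [/clsE -> BZ]] /BZ]].
have [z' [Zz' zz' nz']] := eZ _ Zz.
have XD := calX_down (sZ _ Zz').
pose D : Xelt G := exist _ _ (ex_intro _ v XD).
exists D; split; last by exists z'; split=> //; exact: prefix_le_refl.
exists D; split=> // p /(calX_trim_sub XD) pz'.
exact: (lower_prefix sZ lZ Zz' pz').
Qed.

(** Filters are directed downwards, so a finite part of the support already lies
    in the trimming of one member. *)
Lemma support_finite (F : set (calY G)) (S : set (word G)) : is_filter F ->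
  finite_set S -> S `<=` support F ->
  exists A, F (cls A) /\ S `<=` trim (sval A).
Proof.
move=> fF fS SF; pattern S; apply: finite_set_ind fS => [|B p BS Sp [A [FA BA]]].
  have [[y Fy] _ _ _] := fF; have [A AE] := filter_cls fF Fy.
  by exists A; rewrite -AE; split=> // p [].
have [C [FC Cp]] := SF _ Sp.
have [D [FD [_ DE]]] := filter_meet fF FA FC.
by exists D; split=> //; rewrite DE => q [->|/BA]; [right|left].
Qed.

Lemma supportK (F : set (calY G)) : is_filter F -> filter_of (support F) = F.
Proof.
move=> fF; apply/seteqP; split=> y; last first.
  move=> Fy; have [A AE] := filter_cls fF Fy; subst y.
  by exists A; split=> // p Ap; exists A.
move=> [A [-> AF]]; have [v XA] := svalP A.
have [_ fA _ _ _] := calX_trim XA.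
have [B [FB AB]] := support_finite fF fA AF.
by have [_ _ upF _] := fF; apply: (upF _ _ FB); exact/le_clsP.
Qed.

Lemma supportS (F1 F2 : set (calY G)) : F1 `<=` F2 -> support F1 `<=` support F2.
Proof. by move=> F12 p [A [/F12 FA Ap]]; exists A. Qed.

Lemma filter_ofS Z1 Z2 : Z1 `<=` Z2 -> filter_of Z1 `<=` filter_of Z2.
Proof. by move=> Z12 y [A [yA /subset_trans/(_ Z12) AZ]]; exists A. Qed.

End Trim.

Lemma set_bij_maximal_elements (S T : Type) (P : set (set S)) (Q : set (set T))
    (f : set S -> set T) :
  set_bij P Q f ->
  (forall A B, P A -> P B -> (A `<=` B <-> f A `<=` f B)) ->
  set_bij (maximal_elements P) (maximal_elements Q) f.
Proof.
move=> [Pf injf surjf] ordf; split.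
- move=> A [PA maxA]; split=> [|_ /surjf[B PB <-]]; first exact: Pf.
  by move=> /(ordf _ _ PA PB)/(maxA _ PB) ->.
- by move=> A B /set_mem[PA _] /set_mem[PB _]; apply: injf; exact: mem_set.
- move=> _ [/surjf[A PA <-] maxfA]; exists A => //; split=> // B PB AB.
  apply: injf; [exact: mem_set|exact: mem_set|].
  by apply: maxfA; [exact: Pf|exact/(ordf _ _ PA PB)].
Qed.

Theorem proposition5p2 (G : separated_graph)
    (no_isolated : forall v : vertex G, ~ isolated v) :
  exists phi : set (calY G) -> set (word G),
    [/\ set_bij (filters (calY G)) (frakF G) phi,
        forall F1 F2 : set (calY G), filters (calY G) F1 -> filters (calY G) F2 ->
          (F1 `<=` F2 <-> phi F1 `<=` phi F2) &
        set_bij (ultrafilters (calY G)) (frakU G) phi].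
Proof.
exists (@support G).
have bij : set_bij (filters (calY G)) (frakF G) (@support G).
  split.
  - by move=> F; exact: frakF_support.
  - move=> F1 F2 /set_mem fF1 /set_mem fF2 F12.
    by rewrite -(supportK fF1) F12 supportK.
  - move=> Z fZ; exists (filter_of Z); first exact: filter_of_filter.
    exact: filter_ofK.
have ord F1 F2 : filters (calY G) F1 -> filters (calY G) F2 ->
    (F1 `<=` F2 <-> support F1 `<=` support F2).
  move=> fF1 fF2; split=> [|/filter_ofS]; first exact: supportS.
  by rewrite !supportK.
by split=> //; exact: set_bij_maximal_elements.
Qed.
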